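(* For each class $\mathbb C$ among $\mathbb D$, $\mathbb D'$, $\mathbb I$, $\mathbb I'$, $\mathbb N$, $\mathbb N'$, the category $\mathbf{Top}_{\mathbb C}$ of $\mathbb C$-generated spaces is Cartesian closed.
   Context: All spaces are $T_0$; $\mathbf{Top}$ is the category of $T_0$ spaces and continuous maps. For a class $\mathbb C$ of $T_0$ spaces, a subset $U$ of a space $X$ is $\mathbb C$-open if $k^{-1}(U)$ is open in $C$ for every $C\in\mathbb C$ and every continuous map $k:C\to X$; $X$ is $\mathbb C$-generated if every $\mathbb C$-open subset is open; $\mathbf{Top}_{\mathbb C}$ is the full subcategory of $\mathbf{Top}$ of $\mathbb C$-generated spaces. For a poset $P$ and $\infty\notin P$, with $\uparrow x=\{y\in P:x\le y\}$ for $x\in P$: $\beta_P$ is the topology on $P\cup\{\infty\}$ with subbase all $\uparrow x$ and $\uparrow x\cup\{\infty\}$, $x\in P$; $\gamma_P$ is the topology on $P\cup\{\infty\}$ with subbase all $\uparrow x\cup\{\infty\}$, $x\in P$. Directed posets and chains are non-empty; $N$ is the poset of natural numbers with its usual order. The six classes are: $\mathbb D=\{(D\cup\{\infty\},\beta_D): D$ a directed poset$\}$; $\mathbb D'=\{(D\cup\{\infty\},\gamma_D): D$ a directed poset with no largest element$\}$; $\mathbb I=\{(I\cup\{\infty\},\beta_I): I$ a chain$\}$; $\mathbb I'=\{(I\cup\{\infty\},\gamma_I): I$ a chain with no largest element$\}$; $\mathbb N=\{(N\cup\{\infty\},\beta_N)\}$; $\mathbb N'=\{(N\cup\{\infty\},\gamma_N)\}$.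 *)

(* Defs.v *)
From HB Require Import structures.
From mathcomp Require Import all_boot all_order.
From mathcomp Require Import all_classical topology.
Set Implicit Arguments.
Unset Strict Implicit.
Unset Printing Implicit Defensive.
Import Order.TTheory.
Local Open Scope classical_set_scope.
Local Open Scope order_scope.

Record category := Category {
  obj : Type ;
  hom : obj -> obj -> Type ;
  idmap : forall a, hom a a ;
  compose : forall a b c, hom b c -> hom a b -> hom a c ;
  compose1l : forall a b (f : hom a b), compose (idmap b) f = f ;
  compose1r : forall a b (f : hom a b), compose f (idmap a) = f ;
  composeA : forall a b c e (h : hom c e) (g : hom b c) (f : hom a b),
    compose h (compose g f) = compose (compose h g) f }.

Arguments hom {_} _ _.
Arguments idmap {_} a.
Arguments compose {_ _ _ _} _ _.

Definition full_subcategory (K : category) (P : obj K -> Prop) : category :=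
  @Category {a : obj K | P a} (fun a b => hom (sval a) (sval b))
    (fun a => idmap (sval a)) (fun _ _ _ g f => compose g f)
    (fun _ _ f => compose1l f) (fun _ _ f => compose1r f)
    (fun _ _ _ _ h g f => composeA h g f).

Definition is_terminal (K : category) (t : obj K) : Prop :=
  forall x : obj K, exists! f : hom x t, True.

Record product (K : category) (a b : obj K) := Product {
  prod_obj : obj K ;
  prod_fst : hom prod_obj a ;
  prod_snd : hom prod_obj b ;
  pairing : forall x : obj K, hom x a -> hom x b -> hom x prod_obj ;
  prod_fst_pairing : forall x (f : hom x a) (g : hom x b),
    compose prod_fst (pairing f g) = f ;
  prod_snd_pairing : forall x (f : hom x a) (g : hom x b),
    compose prod_snd (pairing f g) = g ;
  pairing_unique : forall x (f : hom x a) (g : hom x b) (h : hom x prod_obj),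
    compose prod_fst h = f -> compose prod_snd h = g -> h = pairing f g }.

Arguments prod_obj {_ _ _} _.
Arguments prod_fst {_ _ _} _.
Arguments prod_snd {_ _ _} _.
Arguments pairing {_ _ _} _ {x} _ _.

(* [pairing _ (compose h (prod_fst _)) (prod_snd _)] is the morphism h * id_a. *)
Definition is_exponential (K : category) (prods : forall a b : obj K, product a b)
    (a b e : obj K) (ev : hom (prod_obj (prods e a)) b) : Prop :=
  forall (x : obj K) (g : hom (prod_obj (prods x a)) b),
    exists! h : hom x e,
      compose ev (pairing (prods e a) (compose h (prod_fst (prods x a)))
                                       (prod_snd (prods x a))) = g.

Definition cartesian_closed (K : category) : Prop :=
  (exists t : obj K, is_terminal t) /\
  exists prods : forall a b : obj K, product a b,
    forall a b : obj K, exists (e : obj K) (ev : hom (prod_obj (prods e a)) b),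
      is_exponential ev.

Record T0Space := MkT0Space {
  T0_sort :> topologicalType ;
  T0_kolmogorov : kolmogorov_space T0_sort }.

Definition continuous_id (X : topologicalType) : continuousType X X := @idfun X.

Definition continuous_compose (X Y Z : topologicalType)
    (g : continuousType Y Z) (f : continuousType X Y) : continuousType X Z :=
  g \o f.

Lemma continuous_compose1l (X Y : topologicalType) (f : continuousType X Y) :
  continuous_compose (continuous_id Y) f = f.
Proof. exact/continuousEP. Qed.

Lemma continuous_compose1r (X Y : topologicalType) (f : continuousType X Y) :
  continuous_compose f (continuous_id X) = f.
Proof. exact/continuousEP. Qed.

Lemma continuous_composeA (X Y Z T : topologicalType) (h : continuousType Z T)
    (g : continuousType Y Z) (f : continuousType X Y) :
  continuous_compose h (continuous_compose g f) =
  continuous_compose (continuous_compose h g) f.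
Proof. exact/continuousEP. Qed.

Definition Top : category :=
  @Category T0Space (fun X Y => continuousType X Y) (fun X => continuous_id X)
    (fun _ _ _ g f => continuous_compose g f)
    (fun _ _ f => continuous_compose1l f) (fun _ _ f => continuous_compose1r f)
    (fun _ _ _ _ h g f => continuous_composeA h g f).

Definition C_open (C : topologicalType -> Prop) (X : topologicalType) (U : set X) :
    Prop :=
  forall Y : topologicalType, C Y ->
    forall k : continuousType Y X, open (k @^-1` U).

Definition C_generated (C : topologicalType -> Prop) (X : topologicalType) : Prop :=
  forall U : set X, C_open C U -> open U.

Definition Top_generated (C : topologicalType -> Prop) : category :=
  @full_subcategory Top (fun X : T0Space => C_generated C X).

(* The carrier of P + {infinity} is [option P]; infinity is [None]. *)

Section UpSets.
Context {d : Order.disp_t} {P : porderType d}.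

Definition up (x : P) : set (option P) := [set Some y | y in [set y | x <= y]].

Definition up_infty (x : P) : set (option P) := up x `|` [set None].

End UpSets.

Definition beta_space (d : Order.disp_t) (P : porderType d) : Type := option P.

HB.instance Definition _ (d : Order.disp_t) (P : porderType d) :=
  Choice.on (beta_space P).
HB.instance Definition _ (d : Order.disp_t) (P : porderType d) :=
  @isSubBaseTopological.Build (beta_space P) (set (option P))
    (range (@up d P) `|` range (@up_infty d P)) id.

Definition gamma_space (d : Order.disp_t) (P : porderType d) : Type := option P.

HB.instance Definition _ (d : Order.disp_t) (P : porderType d) :=
  Choice.on (gamma_space P).
HB.instance Definition _ (d : Order.disp_t) (P : porderType d) :=
  @isSubBaseTopological.Build (gamma_space P) (set (option P))
    (range (@up_infty d P)) id.

Definition up_directed (d : Order.disp_t) (P : porderType d) : Prop :=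
  [set: P] !=set0 /\ forall x y : P, exists z : P, x <= z /\ y <= z.

Definition is_chain (d : Order.disp_t) (P : porderType d) : Prop :=
  [set: P] !=set0 /\ total (<=%O : rel P).

Definition has_largest (d : Order.disp_t) (P : porderType d) : Prop :=
  exists m : P, forall x : P, x <= m.

Inductive class_D : topologicalType -> Prop :=
  ClassD (d : Order.disp_t) (P : porderType d) of up_directed P :
    class_D (beta_space P).

Inductive class_D' : topologicalType -> Prop :=
  ClassD' (d : Order.disp_t) (P : porderType d) of
    up_directed P & ~ has_largest P : class_D' (gamma_space P).

Inductive class_I : topologicalType -> Prop :=
  ClassI (d : Order.disp_t) (P : porderType d) of is_chain P :
    class_I (beta_space P).

Inductive class_I' : topologicalType -> Prop :=
  ClassI' (d : Order.disp_t) (P : porderType d) of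
    is_chain P & ~ has_largest P : class_I' (gamma_space P).

Inductive class_N : topologicalType -> Prop := ClassN : class_N (beta_space nat).

Inductive class_N' : topologicalType -> Prop :=
  ClassN' : class_N' (gamma_space nat).

(* Main.v *)
Require Import Defs.
From HB Require Import structures.
From mathcomp Require Import all_boot all_order.
From mathcomp Require Import all_classical topology.
Set Implicit Arguments.
Unset Strict Implicit.
Unset Printing Implicit Defensive.
Import Order.TTheory.
Local Open Scope classical_set_scope.
Local Open Scope order_scope.

(** The category of C-generated spaces is Cartesian closed as soon as every
    probing space T in C has this property: if W is a subset of T x T all of
    whose horizontal and vertical slices are open, then the diagonal trace
    {t | (t, t) in W} is open in T ([diagonal_open]).

    All limits and function spaces come from a single construction.  A family
    of maps f_i : A -> Y_i gives A a C-generated topology, in which U is open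
    when p^-1(U) is open for every T in C and every map p : T -> A such that
    all f_i o p are continuous.  This is the initial lift of the family among
    C-generated spaces: the f_i are continuous, and a map into A from a
    C-generated space is continuous once its composites with the f_i are.
    It is T0 when the Y_i are T0 and the f_i separate the points of A.
    The empty family on a point is the terminal object, the two projections
    give the product, and the evaluations at points on the set of continuous
    maps a -> b give the exponential b^a, a refinement of the topology of
    pointwise convergence.  Currying a continuous map is then a matter of
    pointwise continuity.

    The hypothesis on C makes evaluation continuous.  Continuity is tested on
    probes t |-> (k t, x t) with k : T -> b^a and x : T -> a.  The map
    (s, t) |-> k s (x t) is continuous in t because k s is continuous, and in
    s because k is pointwise continuous, so its restriction to the diagonal
    is continuous by [diagonal_open] ([eval_continuous]).

    For a directed poset P, an open set of either topology on P + {oo} is an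
    up-set on P which meets P when it contains oo; for gamma it must moreover
    contain oo when it is nonempty ([beta_openP], [gamma_openP]).  If all
    slices of W are open and (oo, oo) is in W, then moving one coordinate at a
    time produces (oo, x) and then (y, x) in W, hence (z, z) in W for any z
    above x and y; the other conditions on the diagonal are equally direct.
    Chains are directed, so this covers the six classes at once. *)

(** * Initial lifts among generated spaces *)

(** A copy of [A], tagged with the data from which its topology is built. *)
Definition generated_initial (C : topologicalType -> Prop) (A : Type) (I : Type)
  (Y : I -> topologicalType) (f : forall i, A -> Y i) : Type := A.

Section GeneratedInitial.
Context (C : topologicalType -> Prop) (A : choiceType) (I : Type).
Context (Y : I -> topologicalType) (f : forall i, A -> Y i).

Definition probe_open (U : set A) : Prop :=
  forall T : topologicalType, C T -> forall p : T -> A,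
    (forall i, continuous (f i \o p)) -> open (p @^-1` U).

Let probe_openT : probe_open setT.
Proof. by move=> T _ p _; rewrite preimage_setT; exact: openT. Qed.

Let probe_openI : setI_closed probe_open.
Proof.
move=> U V oU oV T CT p cp; rewrite preimage_setI.
by apply: openI; [exact: oU|exact: oV].
Qed.

Let probe_open_bigU (J : Type) (g : J -> set A) :
  (forall j, probe_open (g j)) -> probe_open (\bigcup_j g j).
Proof.
move=> og T CT p cp; rewrite preimage_bigcup.
by apply: bigcup_open => j _; exact: og.
Qed.

HB.instance Definition _ := Choice.on (generated_initial C f).
HB.instance Definition _ := @isOpenTopological.Build (generated_initial C f)
  probe_open probe_openT probe_openI probe_open_bigU.

Local Notation G := (generated_initial C f).

Lemma open_generated_initial : @open G = probe_open.
Proof. by []. Qed.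

Lemma generated_initial_proj i : continuous (f i : G -> Y i).
Proof.
apply/continuousP => V oV; rewrite open_generated_initial => T CT p cp.
by move/continuousP: (cp i); apply.
Qed.

(** The universal property: a probe of [Z] composed with [h] is one of the
    maps that define the topology of [G], and C-generation of [Z] turns this
    probewise statement into continuity. *)
Lemma generated_initial_continuous (Z : topologicalType) (h : Z -> A) :
    C_generated C Z -> (forall i, continuous (f i \o h)) ->
  continuous (h : Z -> G).
Proof.
move=> genZ ch; apply/continuousP => U; rewrite open_generated_initial => oU.
apply: genZ => T CT k; apply: (oU T CT (h \o k)) => i t.
by apply: (@continuous_comp _ _ _ k (f i \o h)); [exact: cts_fun|exact: ch].
Qed.

(** The maps [p] that define the topology of [G] are, by definition of that
    topology, continuous into [G], so they are among its probes. *)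
Lemma generated_initial_generated : C_generated C G.
Proof.
move=> U oU; rewrite open_generated_initial => T CT p cp.
have cpG : continuous (p : T -> G).
  by apply/continuousP => V; rewrite open_generated_initial => oV; exact: oV.
exact: (oU T CT (mkcts cpG)).
Qed.

Lemma generated_initial_kolmogorov :
    (forall i, kolmogorov_space (Y i)) ->
    (forall a b, (forall i, f i a = f i b) -> a = b) ->
  kolmogorov_space G.
Proof.
move=> T0Y injf a b /eqP neab.
have [i /eqP nei] : exists i, f i a <> f i b.
  by apply/existsNP => eqf; exact/neab/injf.
have [V sepV] := T0Y i _ _ nei; exists (f i @^-1` V).
have := @generated_initial_proj i.
case: sepV => -[/set_mem nV /set_mem nVc] cf; [left|right]; split;
  by apply/mem_set => //; exact: cf.
Qed.

End GeneratedInitial.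

(** * Cartesian closedness from a condition on diagonals *)

(** Equivalently, separately continuous maps on [T * T] are continuous along
    the diagonal. *)
Definition diagonal_open (C : topologicalType -> Prop) : Prop :=
  forall T : topologicalType, C T -> forall W : T -> T -> Prop,
    (forall s, open [set t | W s t]) -> (forall t, open [set s | W s t]) ->
  open [set t | W t t].

Section CartesianClosed.
Context (C : topologicalType -> Prop).
Local Notation K := (Top_generated C).
Local Notation space a := (T0_sort (sval a)).

Definition initial_object (A : choiceType) (I : Type) (Y : I -> obj K)
    (f : forall i, A -> space (Y i))
    (injf : forall a b, (forall i, f i a = f i b) -> a = b) : obj K :=
  exist _ (MkT0Space (generated_initial_kolmogorov (C := C)
             (fun i => @T0_kolmogorov (sval (Y i))) injf))
    (@generated_initial_generated C A I _ f).

Definition empty_family (i : void) : obj K := match i with end.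

Definition empty_proj (i : void) : unit -> space (empty_family i) :=
  match i with end.

Lemma empty_proj_inj (a b : unit) :
  (forall i, empty_proj i a = empty_proj i b) -> a = b.
Proof. by case: a b => -[]. Qed.

Lemma terminal_exists : exists t : obj K, is_terminal t.
Proof.
pose t := initial_object empty_proj_inj; exists t => x.
have c1 : continuous ((fun=> tt) : space x -> space t).
  by apply: generated_initial_continuous; [exact: (svalP x)|case].
exists (mkcts c1 : continuousType (space x) (space t)); split => // g _.
by apply/continuousEP => z; case: (g z).
Qed.

Definition pair_family (a b : obj K) (i : bool) : obj K := if i then a else b.

Definition pair_proj (a b : obj K) (i : bool) :
    space a * space b -> space (pair_family a b i) :=
  if i return space a * space b -> space (pair_family a b i) then fst else snd.

Lemma pair_proj_inj (a b : obj K) (u v : space a * space b) :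
  (forall i, pair_proj i u = pair_proj i v) -> u = v.
Proof.
case: u v => [u1 u2] [v1 v2] e.
by congr pair; [exact: (e true)|exact: (e false)].
Qed.

Definition gprod_obj (a b : obj K) : obj K :=
  initial_object (@pair_proj_inj a b).

Lemma gprod_continuous (x a b : obj K) (h : space x -> space (gprod_obj a b)) :
  continuous (fst \o h : space x -> space a) ->
  continuous (snd \o h : space x -> space b) -> continuous h.
Proof.
by move=> c1 c2; apply: generated_initial_continuous;
  [exact: (svalP x)|case].
Qed.

Lemma gprod_fst_continuous (a b : obj K) :
  continuous (fst : space (gprod_obj a b) -> space a).
Proof. exact: (@generated_initial_proj C _ _ _ (@pair_proj a b) true). Qed.

Lemma gprod_snd_continuous (a b : obj K) :
  continuous (snd : space (gprod_obj a b) -> space b).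
Proof. exact: (@generated_initial_proj C _ _ _ (@pair_proj a b) false). Qed.

Lemma gpairing_continuous (a b x : obj K) (f : @hom K x a) (g : @hom K x b) :
  continuous ((fun z => (f z, g z)) : space x -> space (gprod_obj a b)).
Proof. by apply: gprod_continuous; exact: cts_fun. Qed.

Definition gprod (a b : obj K) : product a b.
Proof.
refine (@Product K a b (gprod_obj a b) (mkcts (@gprod_fst_continuous a b))
  (mkcts (@gprod_snd_continuous a b))
  (fun x f g => mkcts (@gpairing_continuous a b x f g)) _ _ _).
- by move=> x f g; apply/continuousEP.
- by move=> x f g; apply/continuousEP.
- move=> x f g h <- <-; apply/continuousEP => z /=.
  exact: surjective_pairing.
Defined.

Definition eval_at (a b : obj K) (x : space a)
  (f : continuousType (space a) (space b)) : space b := f x.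

Lemma eval_at_inj (a b : obj K) (f g : continuousType (space a) (space b)) :
  (forall x, eval_at x f = eval_at x g) -> f = g.
Proof. by move=> e; apply/continuousEP. Qed.

(** The set of morphisms, with the C-generated refinement of the topology of
    pointwise convergence. *)
Definition gexp (a b : obj K) : obj K :=
  initial_object (Y := fun=> b) (@eval_at_inj a b).

Lemma slice_continuous (x a b : obj K) (g : @hom K (gprod_obj x a) b)
    (z : space x) :
  continuous ((fun y => g (z, y)) : space a -> space b).
Proof.
move=> y; apply: (@continuous_comp _ _ _
  ((fun y => (z, y)) : space a -> space (gprod_obj x a)) g); last exact: cts_fun.
apply: gprod_continuous; first exact: (@cst_continuous (space a) (space x) z).
by move=> t; exact: cvg_id.
Qed.

Lemma curry_continuous (x a b : obj K) (g : @hom K (gprod_obj x a) b) :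
  continuous ((fun z => mkcts (@slice_continuous x a b g z)) :
    space x -> space (gexp a b)).
Proof.
apply: generated_initial_continuous; first exact: (svalP x).
move=> y z; apply: (@continuous_comp _ _ _
  ((fun z => (z, y)) : space x -> space (gprod_obj x a)) g); last exact: cts_fun.
apply: gprod_continuous; last exact: (@cst_continuous (space x) (space a) y).
by move=> t; exact: cvg_id.
Qed.

Hypothesis diagC : diagonal_open C.

(** The map (s, t) |-> k s (x t) attached to a probe (k, x) of the product is
    separately continuous, and the probe only sees its diagonal. *)
Lemma eval_continuous (a b : obj K) :
  continuous ((fun u => u.1 u.2) : space (gprod_obj (gexp a b) a) -> space b).
Proof.
apply/continuousP => V oV; apply: (svalP (gprod_obj (gexp a b) a)) => T CT p.
pose k : T -> space (gexp a b) := fst \o p.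
have ck : continuous k.
  move=> t; apply: (@continuous_comp _ _ _ p fst); first exact: cts_fun.
  exact: gprod_fst_continuous.
have cx : continuous (snd \o p : T -> space a).
  move=> t; apply: (@continuous_comp _ _ _ p snd); first exact: cts_fun.
  exact: gprod_snd_continuous.
apply: (diagC CT (W := fun s t => V ((p s).1 (p t).2))) => [s|t].
- have /continuousP : continuous ((p s).1 \o (snd \o p) : T -> space b).
    move=> t; apply: continuous_comp; first exact: cx.
    exact: (@cts_fun _ _ ((p s).1 : continuousType (space a) (space b))).
  exact.
- have /continuousP : continuous (eval_at (p t).2 \o k : T -> space b).
    move=> s; apply: (@continuous_comp _ _ _ k (eval_at (p t).2)).
      exact: ck.
    exact: (@generated_initial_proj C _ _ _ (@eval_at a b)).
  exact.
Qed.

Theorem Top_generated_cartesian_closed : cartesian_closed K.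
Proof.
split; first exact: terminal_exists.
exists gprod => a b; exists (gexp a b), (mkcts (@eval_continuous a b) :
  continuousType (space (gprod_obj (gexp a b) a)) (space b)) => x g.
exists (mkcts (@curry_continuous x a b g) :
  continuousType (space x) (space (gexp a b))); split.
  by apply/continuousEP => -[].
move=> h <-; apply/continuousEP => z; apply/continuousEP => y //.
Qed.

End CartesianClosed.

(** * Open sets of P + {oo} for a directed poset P *)

(** A filter converges to [p] as soon as it contains the subbasic open sets
    around [p].  Applied to a principal filter this shows that open sets are
    up-sets, and applied to the tails of [P] that they meet [P] when they
    contain the point at infinity.  The third premise is openness of [U] for the
    topology with subbase [D], spelled out so as to be convertible with it. *)
Lemma subbase_filter (T : Type) (D : set (set T)) (F : set_system T) (p : T)
    (U : set T) :
    Filter F -> (forall A, D A -> A p -> F A) ->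
    (exists2 B, B `<=` finI_from D id & \bigcup_(A in B) A = U) -> U p -> F U.
Proof.
move=> FF DF [B sB <-] [A BA Ap]; have [E sE AE] := sB _ BA.
apply: (@filterS _ _ FF A) => [q Aq|]; first by exists A.
rewrite -AE; apply: filter_bigI => i iE; apply: DF.
  by have /set_mem := sE _ iE.
by move: Ap; rewrite -AE; apply.
Qed.

Lemma subbase_open (T : choiceType) (D : set (set T)) (A : set T) : D A ->
  exists2 B, B `<=` finI_from D id & \bigcup_(A in B) A = A.
Proof.
move=> DA; exists [set A]; last by rewrite bigcup_set1.
by move=> _ ->; exact: (@finI_from1 _ _ D id).
Qed.

Section DirectedSpaces.
Context {d : Order.disp_t} {P : porderType d}.
Hypothesis dirP : up_directed P.

Definition tails : set_system (option P) :=
  [set U | exists x, forall y, x <= y -> U (Some y)].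

Lemma tails_filter : Filter tails.
Proof.
have [[x0 _] dir] := dirP; split.
- by exists x0.
- move=> U V [x xU] [y yV]; have [z [xz yz]] := dir x y; exists z => t zt.
  by split; [apply: xU|apply: yV]; exact: le_trans zt.
- by move=> U V UV [x xU]; exists x => y /xU /UV.
Qed.

Lemma up_some (x y : P) : up x (Some y) <-> x <= y.
Proof. by split=> [[z xz [<-]]//|xy]; exists y. Qed.

Lemma up_infty_some (x y : P) : up_infty x (Some y) <-> x <= y.
Proof. by split=> [[/up_some//|//]|xy]; left; exact/up_some. Qed.

Lemma up_none (x : P) : ~ up x None.
Proof. by case. Qed.

Lemma up_infty_none (x : P) : up_infty x None.
Proof. by right. Qed.

Lemma beta_openP (U : set (beta_space P)) : open U <->
  (forall x y, x <= y -> U (Some x) -> U (Some y)) /\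
  (U None -> exists x, U (Some x)).
Proof.
split=> [oU|[upU limU]].
  split=> [x y xy Ux|U0].
  - apply/principal_filterP; apply: (subbase_filter _ _ oU Ux).
    move=> _ [[z _ <-]/up_some zx|[z _ <-]/up_infty_some zx];
      apply/principal_filterP.
      exact/up_some/(le_trans zx).
    exact/up_infty_some/(le_trans zx).
  - have [x xU] : tails U.
      apply: (subbase_filter tails_filter _ oU U0).
      move=> _ [[z _ <-]/up_none//|[z _ <-] _].
      by exists z => y /up_infty_some.
    by exists x; exact: xU.
rewrite openE => -[x Ux|U0]; rewrite /interior nbhsE.
  exists (up x).
    split; last exact/up_some.
    by apply: subbase_open; left; exists x.
  by move=> _ [y xy <-]; exact: upU Ux.
have [x Ux] := limU U0; exists (up_infty x).
  split; last exact: up_infty_none.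
  by apply: subbase_open; right; exists x.
by move=> [y /up_infty_some xy|//]; exact: upU Ux.
Qed.

Lemma gamma_openP (U : set (gamma_space P)) : open U <->
  [/\ forall x y, x <= y -> U (Some x) -> U (Some y),
      forall x, U (Some x) -> U None & U None -> exists x, U (Some x)].
Proof.
split=> [oU|[upU upU0 limU]].
  split=> [x y xy Ux|x Ux|U0].
  - apply/principal_filterP; apply: (subbase_filter _ _ oU Ux).
    move=> _ [z _ <-]/up_infty_some zx; apply/principal_filterP.
    exact/up_infty_some/(le_trans zx).
  - apply/principal_filterP; apply: (subbase_filter _ _ oU Ux).
    by move=> _ [z _ <-] _; apply/principal_filterP; exact: up_infty_none.
  - have [x xU] : tails U.
      apply: (subbase_filter tails_filter _ oU U0) => _ [z _ <-] _.
      by exists z => y /up_infty_some.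
    by exists x; exact: xU.
have above p : U p -> exists2 x, U (Some x) & up_infty x p.
  case: p => [x Ux|/limU[x Ux]]; exists x => //; last exact: up_infty_none.
  exact/up_infty_some.
rewrite openE => p /above[x Ux xp]; rewrite /interior nbhsE.
exists (up_infty x).
  by split=> //; apply: subbase_open; exists x.
by move=> [y /up_infty_some xy|_]; [exact: upU Ux|exact: upU0 Ux].
Qed.

(** One coordinate moves at a time, so that only slices are used;
    directedness brings the resulting point back to the diagonal. *)
Lemma diagonal_limit (W : option P -> option P -> Prop) :
    (forall s x y, x <= y -> W s (Some x) -> W s (Some y)) ->
    (forall t x y, x <= y -> W (Some x) t -> W (Some y) t) ->
    (forall s, W s None -> exists x, W s (Some x)) ->
    (forall t, W None t -> exists x, W (Some x) t) ->
  W None None -> exists z, W (Some z) (Some z).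
Proof.
move=> upr upl limr liml /limr[x /liml[y Wyx]].
have [z [xz yz]] := dirP.2 x y.
by exists z; apply: upr xz _; exact: upl yz _.
Qed.

Lemma beta_diagonal_open (W : beta_space P -> beta_space P -> Prop) :
    (forall s, open [set t | W s t]) -> (forall t, open [set s | W s t]) ->
  open [set t | W t t].
Proof.
move=> or ol; have hr s := (beta_openP _).1 (or s).
have hl t := (beta_openP _).1 (ol t).
apply/beta_openP; split=> [x y xy Wx|].
  exact: ((hl _).1 _ _ xy ((hr _).1 _ _ xy Wx)).
apply: diagonal_limit => [s|t|s|t].
- exact: (hr s).1.
- exact: (hl t).1.
- exact: (hr s).2.
- exact: (hl t).2.
Qed.

Lemma gamma_diagonal_open (W : gamma_space P -> gamma_space P -> Prop) :
    (forall s, open [set t | W s t]) -> (forall t, open [set s | W s t]) ->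
  open [set t | W t t].
Proof.
move=> or ol; have hr s := (gamma_openP _).1 (or s).
have hl t := (gamma_openP _).1 (ol t).
apply/gamma_openP; split=> [x y xy Wx|x Wx|].
- have [upl _ _] := hl (Some y); have [upr _ _] := hr (Some x).
  exact: upl xy (upr _ _ xy Wx).
- have [_ infl _] := hl None; have [_ infr _] := hr (Some x).
  exact: infl (infr _ Wx).
- apply: diagonal_limit => [s|t|s|t].
  + by have [] := hr s.
  + by have [] := hl t.
  + by have [] := hr s.
  + by have [] := hl t.
Qed.

End DirectedSpaces.

Lemma chain_directed (d : Order.disp_t) (P : porderType d) :
  is_chain P -> up_directed P.
Proof.
move=> [P0 tot]; split=> // x y.
by case/orP: (tot x y) => ?; [exists y|exists x].
Qed.

Lemma nat_directed : up_directed nat.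
Proof. by apply: chain_directed; split; [exists 0|exact: le_total]. Qed.

Theorem theorem36 :
  cartesian_closed (Top_generated class_D) /\
  cartesian_closed (Top_generated class_D') /\
  cartesian_closed (Top_generated class_I) /\
  cartesian_closed (Top_generated class_I') /\
  cartesian_closed (Top_generated class_N) /\
  cartesian_closed (Top_generated class_N').
Proof.
split; [|split; [|split; [|split; [|split]]]];
  apply: Top_generated_cartesian_closed => T [].
- by move=> d P dirP; exact: beta_diagonal_open.
- by move=> d P dirP _; exact: gamma_diagonal_open.
- by move=> d P /chain_directed; exact: beta_diagonal_open.
- by move=> d P /chain_directed dirP _; exact: gamma_diagonal_open.
- exact: beta_diagonal_open nat_directed.
- exact: gamma_diagonal_open nat_directed.
Qed.
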